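(* Let $M$ be a smooth manifold with Riemannian metrics $g_0,g_1$, and let $f:M\to[0,1]$ be a smooth function. Equip $M\times M$ with the Riemannian metric $\overline{g}:=\pi_1^*\big((1-f)g_0\big)+\pi_2^*\big(fg_1\big)$, where $\pi_1,\pi_2:M\times M\to M$ are the projections onto the first and second factors, and let $\Xi:M\to M\times M$, $\Xi(p)=(p,p)$, with image $\Gamma_{\mathrm{Id}_M}=\{(p,p):p\in M\}$. Let $\sigma$ denote the second fundamental form of $\Gamma_{\mathrm{Id}_M}\subset(M\times M,\overline{g})$. Define the difference tensor $D(X,Y):=\nabla'_XY-\nabla_XY$, where $\nabla'$ and $\nabla$ are the Levi-Civita connections of $fg_1$ and $(1-f)g_0$, respectively. Then for any $p\in M$ and any $X,Y,X',Y'\in T_pM$, $$\overline{g}\Bigl(\sigma\bigl(d\Xi(X),d\Xi(Y)\bigr),\,\sigma\bigl(d\Xi(X'),d\Xi(Y')\bigr)\Bigr)=fg_1\Bigl((1+P)^{-1}D(X,Y),\,D(X',Y')\Bigr).$$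
   Context: At each $p\in M$, $P:T_pM\to T_pM$ is the unique symmetric, positive-definite endomorphism satisfying $(1-f)g_0(PX,Y)=fg_1(X,Y)$ for all $X,Y\in T_pM$. In $1+P$, $1$ denotes the identity endomorphism. The second fundamental form is the normal-bundle-valued form given by the $\overline{g}$-normal component of the Levi-Civita connection of $\overline{g}$. *)

(* Defs.v *)
From HB Require Import structures.
From mathcomp Require Import all_boot all_order all_algebra.
From mathcomp Require Import all_classical all_reals all_analysis.
Set Implicit Arguments.
Unset Strict Implicit.
Unset Printing Implicit Defensive.
Import Order.TTheory GRing.Theory Num.Theory numFieldNormedType.Exports.
Local Open Scope classical_set_scope.
Local Open Scope ring_scope.

Section smooth_maps.
Context {R : realType}.
Implicit Types V W : normedModType R.

(* Only used for U open and V, W finite-dimensional; there, F is C^(k+1) iff it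
   is differentiable and dF is C^k, i.e. all the maps x |-> dF_x(v) are C^k. *)
Fixpoint Ck_on {V W} (k : nat) (U : set V) (F : V -> W) : Prop :=
  if k is k'.+1 then
    (forall x, U x -> differentiable F x) /\
    (forall v, Ck_on k' U (fun x => 'd F x v))
  else forall x, U x -> {for x, continuous F}.

Definition smooth_on {V W} (U : set V) (F : V -> W) := forall k, Ck_on k U F.

Lemma eq_differentiable {V W} (U : set V) (F G : V -> W) (x : V) :
  open U -> {in U, F =1 G} -> U x -> differentiable F x ->
  differentiable G x /\ 'd G x = 'd F x :> (V -> W).
Proof.
move=> oU FG Ux dF.
have nU : \forall h \near (0 : V), U (h + x).
  have : \forall y \near x, U y by exact: open_nbhs_nbhs.
  by rewrite (near_shift 0) /= subr0.
have dFc : continuous ('d F x) by exact: diff_continuous.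
have /diff_locallyxP[_ eF] := dF.
have GE : G \o shift x = cst (G x) + 'd F x +o_ (0 : V) id.
  apply/eqaddoP => e e0.
  have /eqaddoP/(_ e e0) Fo : F \o shift x = cst (F x) + 'd F x +o_ (0 : V) id.
    by apply/eqaddoE; apply/funext => h; exact: eF.
  near=> h.
  have Uhx : U (h + x) by near: h.
  rewrite [X in `|X|](_ : _ = (F \o shift x - (cst (F x) + 'd F x)) h); last first.
    by rewrite !fctE /= !FG ?inE.
  by near: h.
have dG := diff_unique dFc GE.
split=> //; apply/diff_locallyxP; rewrite dG; split=> // h.
by rewrite -[LHS]/((G \o shift x) h) GE.
Unshelve. all: by end_near. Qed.

Lemma eq_Ck_on {V W} k (U : set V) (F G : V -> W) :
  open U -> {in U, F =1 G} -> Ck_on k U F -> Ck_on k U G.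
Proof.
move=> oU; elim: k F G => [|k IH] F G FG /=.
  move=> cF x Ux; have cFx : F y @[y --> x] --> F x by exact: cF.
  have GF : {near x, F =1 G}.
    near=> y; rewrite FG // inE; near: y; exact: open_nbhs_nbhs.
  rewrite /prop_for /continuous_at -(FG x) ?inE //.
  exact: cvg_trans (near_eq_cvg GF) cFx.
move=> [dF CF]; split=> [x Ux|v].
  by have [] := eq_differentiable oU FG Ux (dF x Ux).
apply: IH (CF v) => x; rewrite inE => Ux.
by have [_ ->] := eq_differentiable oU FG Ux (dF x Ux).
Unshelve. all: by end_near. Qed.

Lemma open_setX {T1 T2 : topologicalType} (A : set T1) (B : set T2) :
  open A -> open B -> open (A `*` B).
Proof.
move=> oA oB; rewrite openE => -[x y] [/= Ax By].
by exists (A, B) => //=; split; exact: open_nbhs_nbhs.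
Qed.

Lemma smooth_on_prod {V1 W1 V2 W2 : normedModType R} (U1 : set V1) (U2 : set V2)
    (F1 : V1 -> W1) (F2 : V2 -> W2) :
  open U1 -> open U2 -> smooth_on U1 F1 -> smooth_on U2 F2 ->
  smooth_on (U1 `*` U2) (fun z => (F1 z.1, F2 z.2)).
Proof.
move=> oU1 oU2 s1 s2 k; elim: k W1 W2 F1 F2 s1 s2 => [|k IH] W1 W2 F1 F2 s1 s2 /=.
  move=> z [/= z1 z2].
  have c1 : F1 y.1 @[y --> z] --> F1 z.1.
    by apply: (@cvg_comp _ _ _ fst F1) (s1 0%N z.1 z1); exact: cvg_fst.
  have c2 : F2 y.2 @[y --> z] --> F2 z.2.
    by apply: (@cvg_comp _ _ _ snd F2) (s2 0%N z.2 z2); exact: cvg_snd.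
  exact: cvg_pair c1 c2.
have oU : open (U1 `*` U2) by exact: open_setX.
have dF z : (U1 `*` U2) z -> differentiable (fun z => (F1 z.1, F2 z.2)) z /\
    'd (fun z => (F1 z.1, F2 z.2)) z =
      (fun v => ('d F1 (z.1) v.1, 'd F2 (z.2) v.2)) :> (_ -> _).
  move=> [/= z1 z2].
  have d1 : differentiable F1 z.1 by have [+ _] := s1 1%N; exact.
  have d2 : differentiable F2 z.2 by have [+ _] := s2 1%N; exact.
  have df : differentiable (fst : V1 * V2 -> V1) z.
    by apply: linear_differentiable => ?; exact: cvg_fst.
  have ds : differentiable (snd : V1 * V2 -> V2) z.
    by apply: linear_differentiable => ?; exact: cvg_snd.
  have e1 : differentiable (F1 \o fst) z by exact: differentiable_comp.
  have e2 : differentiable (F2 \o snd) z by exact: differentiable_comp.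
  split; first exact: differentiable_pair e1 e2.
  rewrite (diff_pair e1 e2) (diff_comp df d1) (diff_comp ds d2).
  have -> : 'd (fst : V1 * V2 -> V1) z = fst :> (_ -> _).
    by apply: diff_lin => ?; exact: cvg_fst.
  have -> // : 'd (snd : V1 * V2 -> V2) z = snd :> (_ -> _).
  by apply: diff_lin => ?; exact: cvg_snd.
split=> [z /dF[]//|v].
apply: (@eq_Ck_on _ _ k _ (fun z => ('d F1 (z.1) v.1, 'd F2 (z.2) v.2)) _ oU).
  by move=> z; rewrite inE => /dF[_ ->].
apply: (IH _ _ (fun x => 'd F1 x v.1) (fun x => 'd F2 x v.2)) => j.
- by have [_] := s1 j.+1; exact.
- by have [_] := s2 j.+1; exact.
Qed.
End smooth_maps.

(* [chart_map] and [chart_inv] are only meaningful on [chart_dom] and on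
   [chart_map @` chart_dom] respectively. *)
Record chart (R : realType) (M : topologicalType) (V : normedModType R) := Chart {
  chart_dom : set M;
  chart_map : M -> V;
  chart_inv : V -> M;
  open_chart_dom : open chart_dom;
  open_chart_img : open (chart_map @` chart_dom);
  chartK : {in chart_dom, cancel chart_map chart_inv};
  chart_map_continuous :
    forall p, chart_dom p -> {for p, continuous chart_map};
  chart_inv_continuous :
    forall x, (chart_map @` chart_dom) x -> {for x, continuous chart_inv} }.

(* A smooth atlas on M, modelled on V, with a chosen chart around each point. *)
Record smooth_structure (R : realType) (M : topologicalType)
    (V : normedModType R) := SmoothStructure {
  chart_index : Type;
  charts : chart_index -> chart M V;
  index_at : M -> chart_index;
  mem_index_at : forall p, chart_dom (charts (index_at p)) p;
  smooth_transition : forall i j,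
    smooth_on
      (chart_map (charts i) @` (chart_dom (charts i) `&` chart_dom (charts j)))
      (chart_map (charts j) \o chart_inv (charts i)) }.

Section product.
Context {R : realType} {M1 M2 : topologicalType} {V1 V2 : normedModType R}.

Section chart.
Variables (c1 : chart M1 V1) (c2 : chart M2 V2).
Let dom := chart_dom c1 `*` chart_dom c2.
Let map := fun p : M1 * M2 => (chart_map c1 p.1, chart_map c2 p.2).
Let inv := fun x : V1 * V2 => (chart_inv c1 x.1, chart_inv c2 x.2).

Lemma image_setX (D1 : set M1) (D2 : set M2) :
  map @` (D1 `*` D2) = (chart_map c1 @` D1) `*` (chart_map c2 @` D2).
Proof.
apply/seteqP; split=> [_ [[p q] [/= Dp Dq] <-]|[x y] [/= [p Dp <-] [q Dq <-]]].
  by split; [exists p|exists q].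
by exists (p, q).
Qed.

Let open_dom : open dom.
Proof. by apply: open_setX; exact: open_chart_dom. Qed.

Let open_img : open (map @` dom).
Proof. by rewrite image_setX; apply: open_setX; exact: open_chart_img. Qed.

Let mapK : {in dom, cancel map inv}.
Proof.
by move=> [p q]; rewrite inE => -[/= Dp Dq]; rewrite /map /inv /= !chartK ?inE.
Qed.

Let map_continuous p : dom p -> {for p, continuous map}.
Proof.
move=> [p1 p2].
have k1 : chart_map c1 q.1 @[q --> p] --> chart_map c1 p.1.
  apply: (@cvg_comp _ _ _ fst (chart_map c1)) (chart_map_continuous p1).
  exact: cvg_fst.
have k2 : chart_map c2 q.2 @[q --> p] --> chart_map c2 p.2.
  apply: (@cvg_comp _ _ _ snd (chart_map c2)) (chart_map_continuous p2).
  exact: cvg_snd.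
exact: cvg_pair k1 k2.
Qed.

Let inv_continuous x : (map @` dom) x -> {for x, continuous inv}.
Proof.
rewrite image_setX => -[x1 x2].
have k1 : chart_inv c1 q.1 @[q --> x] --> chart_inv c1 x.1.
  apply: (@cvg_comp _ _ _ fst (chart_inv c1)) (chart_inv_continuous x1).
  exact: cvg_fst.
have k2 : chart_inv c2 q.2 @[q --> x] --> chart_inv c2 x.2.
  apply: (@cvg_comp _ _ _ snd (chart_inv c2)) (chart_inv_continuous x2).
  exact: cvg_snd.
exact: cvg_pair k1 k2.
Qed.

Definition prod_chart : chart (M1 * M2)%type (V1 * V2)%type :=
  Chart open_dom open_img mapK map_continuous inv_continuous.
End chart.

Lemma open_overlap {M : topologicalType} {V : normedModType R} (c d : chart M V) :
  open (chart_map c @` (chart_dom c `&` chart_dom d)).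
Proof.
rewrite openE => _ [p [cp dp] <-].
have img_p : (chart_map c @` chart_dom c) (chart_map c p) by exists p.
have nd : \forall x \near chart_map c p, chart_dom d (chart_inv c x).
  apply: (chart_inv_continuous img_p); rewrite chartK ?inE //.
  by apply: open_nbhs_nbhs; split=> //; exact: open_chart_dom.
have ni : \forall x \near chart_map c p, (chart_map c @` chart_dom c) x.
  by apply: open_nbhs_nbhs; split=> //; exact: open_chart_img.
rewrite /interior /=; near=> x.
have [q cq qx] : (chart_map c @` chart_dom c) x by near: x.
exists q => //; split=> //.
rewrite -[q](chartK (c := c)) ?inE // qx; by near: x.
Unshelve. all: by end_near. Qed.

Variables (A1 : smooth_structure M1 V1) (A2 : smooth_structure M2 V2).

Let prod_charts (i : chart_index A1 * chart_index A2) :=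
  prod_chart (charts i.1) (charts i.2).

Let prod_transition i j :
  smooth_on
    (chart_map (prod_charts i) @`
      (chart_dom (prod_charts i) `&` chart_dom (prod_charts j)))
    (chart_map (prod_charts j) \o chart_inv (prod_charts i)).
Proof.
rewrite [_ `&` _](_ : _ =
    (chart_dom (charts i.1) `&` chart_dom (charts j.1)) `*`
    (chart_dom (charts i.2) `&` chart_dom (charts j.2))); last first.
  apply/seteqP; split=> [[p q] [[/= ? ?] [/= ? ?]]|[p q] [[/= ? ?] [/= ? ?]]] //.
rewrite image_setX.
have := smooth_on_prod (open_overlap _ _) (open_overlap _ _)
  (smooth_transition (s := A1) i.1 j.1) (smooth_transition (s := A2) i.2 j.2).
exact.
Qed.

Let prod_mem_index_at (p : M1 * M2) :
  chart_dom (prod_charts (index_at A1 p.1, index_at A2 p.2)) p.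
Proof. by split; exact: mem_index_at. Qed.

Definition prod_structure : smooth_structure (M1 * M2)%type (V1 * V2)%type :=
  SmoothStructure prod_mem_index_at prod_transition.
End product.

(* A tangent vector at p is identified with its components in the chosen chart
   around p. *)
Definition tangent {R : realType} {M : topologicalType} {V : normedModType R}
  (A : smooth_structure M V) (p : M) : normedModType R := V.

Definition vector_field {R : realType} {M : topologicalType}
  {V : normedModType R} (A : smooth_structure M V) := forall p, tangent A p.

Definition pairing {R : realType} {M : topologicalType} {V : normedModType R}
  (A : smooth_structure M V) := forall p, tangent A p -> tangent A p -> R.

Section calculus.
Context {R : realType} {M : topologicalType} {V : normedModType R}.
Variable A : smooth_structure M V.

Definition chart_at (p : M) : chart M V := charts (index_at A p).

Definition components (i : chart_index A) (p : M) (v : tangent A p) : V :=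
  'd (chart_map (charts i) \o chart_inv (chart_at p))
     (chart_map (chart_at p) p) v.

Definition smooth_fun (U : set M) (h : M -> R) := forall i : chart_index A,
  smooth_on (chart_map (charts i) @` (chart_dom (charts i) `&` U))
    (h \o chart_inv (charts i)).

Definition smooth_field (U : set M) (X : vector_field A) :=
  forall i : chart_index A,
  smooth_on (chart_map (charts i) @` (chart_dom (charts i) `&` U))
    (fun x => let q := chart_inv (charts i) x in components i (X q)).

Definition smooth_fun_near (p : M) (h : M -> R) :=
  exists2 U, open_nbhs p U & smooth_fun U h.

Definition smooth_field_near (p : M) (X : vector_field A) :=
  exists2 U, open_nbhs p U & smooth_field U X.

(* v(h) *)
Definition derivation (p : M) (v : tangent A p) (h : M -> R) : R :=
  'd (h \o chart_inv (chart_at p)) (chart_map (chart_at p) p) v.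

(* w = [X, Y]_p *)
Definition is_lie_bracket (X Y : vector_field A) (p : M) (w : tangent A p) :=
  forall h, smooth_fun_near p h ->
    derivation w h = derivation (X p) (fun q => derivation (Y q) h)
                   - derivation (Y p) (fun q => derivation (X q) h).

Definition scale_pairing (h : M -> R) (g : pairing A) : pairing A :=
  fun p X Y => h p * g p X Y.

Record riemannian_metric (g : pairing A) : Prop := {
  metric_linear : forall p Y, scalar (fun X => g p X Y);
  metric_sym : forall p X Y, g p X Y = g p Y X;
  metric_gt0 : forall p X, X != 0 -> 0 < g p X X;
  metric_smooth : forall U X Y, open U -> smooth_field U X ->
    smooth_field U Y -> smooth_fun U (fun p => g p (X p) (Y p)) }.

(* [nabla p v Y] is the derivative of Y at p in the direction v. As connections
   are local operators, they are taken to act on all vector fields Y that are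
   smooth near p; the values on other Y are irrelevant. *)
Definition connection := forall p, tangent A p -> vector_field A -> tangent A p.

Record affine_connection (nabla : connection) : Prop := {
  connection_linear : forall p Y, smooth_field_near p Y ->
    linear (fun v => nabla p v Y);
  connection_add : forall p v Y Z,
    smooth_field_near p Y -> smooth_field_near p Z ->
    nabla p v (fun q => Y q + Z q) = nabla p v Y + nabla p v Z;
  connection_leibniz : forall p v h Y,
    smooth_fun_near p h -> smooth_field_near p Y ->
    nabla p v (fun q => h q *: Y q) =
      derivation v h *: Y p + h p *: nabla p v Y;
  connection_smooth : forall U X Y, open U -> smooth_field U X ->
    smooth_field U Y -> smooth_field U (fun p => nabla p (X p) Y) }.

Record levi_civita (g : pairing A) (nabla : connection) : Prop := {
  levi_civita_affine : affine_connection nabla;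
  levi_civita_torsion_free : forall p X Y,
    smooth_field_near p X -> smooth_field_near p Y ->
    is_lie_bracket X Y (nabla p (X p) Y - nabla p (Y p) X);
  levi_civita_metric : forall p v Y Z,
    smooth_field_near p Y -> smooth_field_near p Z ->
    derivation v (fun q => g q (Y q) (Z q)) =
      g p (nabla p v Y) (Z p) + g p (Y p) (nabla p v Z) }.

(* nabla'_X Y - nabla_X Y, where the tangent vector Y at p is extended
   to a vector field; the value does not depend on the extension. *)
Definition difference_tensor (nabla' nabla : connection) (p : M)
    (X Y : tangent A p) : tangent A p :=
  xget 0 [set w | exists Z : vector_field A,
    [/\ smooth_field_near p Z, Z p = Y & w = nabla' p X Z - nabla p X Z]].

(* Symmetry and positivity are with respect to g0, equivalently (1 - f) g0. *)
Record comparison_endomorphism (f : M -> R) (g0 g1 : pairing A) (p : M)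
    (P : {linear tangent A p -> tangent A p}) : Prop := {
  comparison_sym : forall X Y, g0 p (P X) Y = g0 p X (P Y);
  comparison_gt0 : forall X, X != 0 -> 0 < g0 p (P X) X;
  comparisonE : forall X Y, (1 - f p) * g0 p (P X) Y = f p * g1 p X Y }.

End calculus.

Section maps.
Context {R : realType} {M N : topologicalType} {V W : normedModType R}.
Variables (A : smooth_structure M V) (B : smooth_structure N W) (F : M -> N).

Definition dmap (p : M) (v : tangent A p) : tangent B (F p) :=
  'd (chart_map (chart_at B (F p)) \o F \o chart_inv (chart_at A p))
     (chart_map (chart_at A p) p) v.

Definition pullback (g : pairing B) : pairing A :=
  fun p X Y => g (F p) (dmap X) (dmap Y).

(* The default value 0 of xget plays no role below: for g Riemannian the sets are
   singletons. In both definitions F is an embedding and the submanifold is its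
   image, with tangent space dF(T_p M) at F(p). *)
Definition normal_component (g : pairing B) (p : M) (w : tangent B (F p)) :
    tangent B (F p) :=
  xget 0 [set u | (forall v : tangent A p, g (F p) u (dmap v) = 0) /\
                  range (@dmap p) (w - u)].

(* sigma(u, v) is the normal component of nabla_u Z, for any local vector field
   Z extending v that is tangent to the submanifold along it. *)
Definition second_fundamental_form (g : pairing B) (nabla : connection B) (p : M)
    (u v : tangent B (F p)) : tangent B (F p) :=
  xget 0 [set w | exists Z : vector_field B,
    [/\ smooth_field_near (F p) Z,
        \forall q \near p, range (@dmap q) (Z (F q)),
        Z (F p) = v
      & w = normal_component g (nabla (F p) u Z)]].

End maps.

Arguments second_fundamental_form {R M N V W} A B F g nabla p u v.

(* Main.v *)
Require Import Defs.
From HB Require Import structures.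
From mathcomp Require Import all_boot all_order all_algebra.
From mathcomp Require Import all_classical all_reals all_analysis.
From mathcomp Require Import lra.
Set Implicit Arguments.
Unset Strict Implicit.
Unset Printing Implicit Defensive.
Import Order.TTheory GRing.Theory Num.Theory numFieldNormedType.Exports.
Local Open Scope classical_set_scope.
Local Open Scope ring_scope.

(** Write [h0] for [(1 - f) g0] and [h1] for [f g1]. The Levi-Civita connection of the
    product metric [h0 + h1] on [M * M] is the product of [nabla] and [nabla']. Hence,
    if [Z] extends [dXi Y] and is tangent to the diagonal, its derivative along
    [dXi X] is [(t + nabla_X Y, t + nabla'_X Y)], where [Y] is extended with constant
    components in a chart and [t] is the derivative of the common components of
    [Z]. Modulo the tangent space of the diagonal this is [(0, D X Y)]
    ([second_fundamental_form_diag]). By definition of [P], [h0 (P x) y = h1 x y], so the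
    normal vectors are the [(- P s, s)], and the one congruent to [(0, D)] has
    [s = (1 + P)^-1 D] ([normal_component_diag]). Finally
    [h0 (P s) (P s') + h1 s s' = h1 s ((1 + P) s') = h1 s D'].

    The geometric work is the description of [nablabar]. All connections are
    compared on fields with constant components in the chart at a point
    ([const_field]), whose brackets vanish. For a general field,
    [connection_expand] gives its covariant derivative as the derivative of its
    components plus the covariant derivative of the constant field with the same
    value. On constant fields, [levi_civita_prod] identifies [nablabar] with the
    product connection by the usual uniqueness argument: a trilinear form
    symmetric in its first two and antisymmetric in its last two arguments
    vanishes. Smoothness of constant fields and of components rests on the chain
    rule for maps of class C^k between spaces with finitely many coordinates
    ([frame], [Ck_on_comp]). *)

(** * Differentials *)

Section differentials.
Context {R : realType}.
Implicit Types V W : normedModType R.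

Lemma near_eq_is_diff {V W} (F G dF : V -> W) (x : V) :
  (\forall y \near x, F y = G y) -> is_diff x F dF -> is_diff x G dF.
Proof.
move=> FG [dFx <-].
have [dG E] : differentiable G x /\ 'd G x = 'd F x :> (V -> W).
  apply: (@eq_differentiable _ _ _ ([set y | F y = G y]^°) F G) => //.
  - exact: open_interior.
  - by move=> y; rewrite inE => /interior_subset.
by split.
Qed.

Lemma is_diff_linear {V W} (L : {linear V -> W}) (x : V) :
  continuous L -> is_diff x L L.
Proof.
by move=> cL; split; [exact: linear_differentiable|rewrite diff_lin].
Qed.

(** The product rule, as the chain rule through the bilinear map [*:%R]. *)
Lemma is_diff_scale {V W} (a da : V -> R) (F dF : V -> W) (x : V) :
  is_diff x a da -> is_diff x F dF ->
  is_diff x (fun y => a y *: F y) (fun v => a x *: dF v + da v *: F x).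
Proof.
move=> ax Fx.
have cs : continuous (fun z : R * W => z.1 *: z.2) by exact: scale_continuous.
have lb : bilinear_for (GRing.Scale.Law.clone _ _ *:%R _)
    (GRing.Scale.Law.clone _ _ *:%R _) (@GRing.scale R W : R -> W -> W).
  split=> [u'|u] b y z /=; first by rewrite scalerDl scalerA.
  by rewrite scalerDr !scalerA mulrC.
pose bM := bilinear_isBilinear.Build R R W W _ _ _ lb.
pose b : {bilinear R -> W -> W} := HB.pack (@GRing.scale R W : R -> W -> W) bM.
have ds : is_diff (a x, F x) (fun z : R * W => b z.1 z.2)
    (fun z => b (a x) z.2 + b z.1 (F x)).
  by split; [exact: differentiable_bilin|rewrite diff_bilin].
exact: (@is_diff_comp _ _ _ _ (fun y => (a y, F y)) (fun v => (da v, dF v))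
  (fun z => b z.1 z.2) _ x (is_diff_pair ax Fx) ds).
Qed.

End differentials.

Section product_differential.
Context {R : realType} {V1 V2 W1 W2 : normedModType R}.

Lemma is_diff_fst (z : V1 * V2) : is_diff z (@fst V1 V2) fst.
Proof. by apply: is_diff_linear => ?; exact: cvg_fst. Qed.

Lemma is_diff_snd (z : V1 * V2) : is_diff z (@snd V1 V2) snd.
Proof. by apply: is_diff_linear => ?; exact: cvg_snd. Qed.

Lemma is_diff_prod_map (F1 dF1 : V1 -> W1) (F2 dF2 : V2 -> W2) (z : V1 * V2) :
  is_diff (z.1) F1 dF1 -> is_diff (z.2) F2 dF2 ->
  is_diff z (fun x : V1 * V2 => (F1 x.1, F2 x.2))
    (fun v : V1 * V2 => (dF1 v.1, dF2 v.2)).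
Proof.
move=> D1 D2.
exact: is_diff_pair (is_diff_comp (is_diff_fst z) D1)
  (is_diff_comp (is_diff_snd z) D2).
Qed.

End product_differential.

Lemma is_diff_diag {R : realType} {V : normedModType R} (x : V) :
  is_diff x (fun y => (y, y)) (fun v => (v, v)).
Proof.
exact: (@is_diff_pair _ _ _ _ id id id id _ (is_diff_id _) (is_diff_id _)).
Qed.

(** * Closure properties of maps of class C^k *)

Section Ck_closure.
Context {R : realType}.
Implicit Types V W : normedModType R.

Lemma Ck_on_differentiable {V W} k (U : set V) (F : V -> W) x :
  Ck_on k.+1 U F -> U x -> differentiable F x.
Proof. by case=> dF _ /dF. Qed.

(** The recursive definition of [Ck_on] speaks of ['d F x]; this form lets a
    closed formula for the differential, valid on [U] only, take its place. *)
Lemma Ck_on_is_diff {V W} k (U : set V) (F : V -> W) (dF : V -> V -> W) :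
  open U -> (forall x, U x -> is_diff x F (dF x)) ->
  (forall v, Ck_on k U (dF ^~ v)) -> Ck_on k.+1 U F.
Proof.
move=> oU FU CF; split=> [x /FU[]//|v].
apply: eq_Ck_on (CF v) => // x; rewrite inE => /FU[_ ->]//.
Qed.

Lemma Ck_onW {V W} k (U : set V) (F : V -> W) : Ck_on k.+1 U F -> Ck_on k U F.
Proof.
elim: k F => [|k IH] F [dF CF].
  by move=> x /dF; exact: differentiable_continuous.
by split=> // v; apply: IH.
Qed.

Lemma Ck_onS {V W} k (B B' : set V) (F : V -> W) :
  B' `<=` B -> Ck_on k B F -> Ck_on k B' F.
Proof.
move=> sB; elim: k F => [|k IH] F; first by move=> cF x /sB; exact: cF.
by move=> [dF CF]; split=> [x /sB|v]; [exact: dF|apply: IH (CF v)].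
Qed.

Lemma Ck_on_cst {V W} k (U : set V) (w : W) : open U -> Ck_on k U (cst w : V -> W).
Proof.
move=> oU; elim: k w => [|k IH] w; first by move=> x _; exact: cst_continuous.
apply: (@Ck_on_is_diff _ _ _ _ _ (fun _ => 0)) => // v; exact: IH.
Qed.

Lemma Ck_onD {V W} k (U : set V) (F G : V -> W) : open U ->
  Ck_on k U F -> Ck_on k U G -> Ck_on k U (fun x => F x + G x).
Proof.
move=> oU; elim: k F G => [|k IH] F G.
  by move=> cF cG x Ux; apply: continuousD; [exact: cF|exact: cG].
move=> [dF CF] [dG CG].
apply: (@Ck_on_is_diff _ _ _ _ _ (fun x v => 'd F x v + 'd G x v)) => //.
- move=> x Ux.
  exact: (@is_diffD _ _ _ F G _ _ x (differentiableP (dF x Ux))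
    (differentiableP (dG x Ux))).
- by move=> v; apply: IH; [exact: CF|exact: CG].
Qed.

Lemma Ck_onZ {V W} k (U : set V) (a : V -> R) (F : V -> W) : open U ->
  Ck_on k U a -> Ck_on k U F -> Ck_on k U (fun x => a x *: F x).
Proof.
move=> oU; elim: k a F => [|k IH] a F.
  move=> ca cF x Ux; apply: cvgZ; [exact: ca|exact: cF].
move=> Ca CF; have [da Cda] := Ca; have [dF CdF] := CF.
apply: (@Ck_on_is_diff _ _ _ _ _
  (fun x v => a x *: 'd F x v + 'd a x v *: F x)) => //.
- move=> x Ux; apply: is_diff_scale; apply/differentiableP;
    [exact: da|exact: dF].
- move=> v; apply: Ck_onD => //; apply: IH.
  + exact: Ck_onW.
  + exact: CdF.
  + exact: Cda.
  + exact: Ck_onW.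
Qed.

Lemma Ck_on_sum {V W} k (U : set V) (I : eqType) (r : seq I) (F : I -> V -> W) :
  open U -> (forall i, Ck_on k U (F i)) ->
  Ck_on k U (fun x => \sum_(i <- r) F i x).
Proof.
move=> oU CF; elim: r => [|i r IH].
  by under eq_fun do rewrite big_nil; exact: Ck_on_cst.
by under eq_fun do rewrite big_cons; exact: Ck_onD.
Qed.

Lemma Ck_on_linear {V W W'} k (U : set V) (L : {linear W -> W'}) (F : V -> W) :
  open U -> continuous L -> Ck_on k U F -> Ck_on k U (L \o F).
Proof.
move=> oU cL; elim: k F => [|k IH] F.
  by move=> cF x Ux; apply: continuous_comp; [exact: cF|exact: cL].
move=> [dF CF]; apply: (@Ck_on_is_diff _ _ _ _ _ (fun x => L \o 'd F x)) => //.
- move=> x Ux; apply: is_diff_comp; first exact/differentiableP/dF.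
  exact: is_diff_linear.
- by move=> v; apply: IH; exact: CF.
Qed.

End Ck_closure.

(** * Frames and composition *)

(** A finite spanning family with continuous coordinates. It is what makes the
    chain rule stay within [Ck_on]: the class C^k of a differential is only
    recorded direction by direction, so [x |-> 'd G (F x) ('d F x v)] has to be
    expanded over finitely many fixed directions. *)
Record frame {R : realType} (V : normedModType R) := Frame {
  frame_index : finType;
  frame_vec : frame_index -> V;
  frame_coord : frame_index -> {linear V -> R};
  frame_coord_continuous : forall i, continuous (frame_coord i);
  frame_sum : forall v, v = \sum_i frame_coord i v *: frame_vec i }.

Arguments frame_vec {R V} f i.
Arguments frame_coord {R V} f i.

Section frames.
Context {R : realType}.

Definition row_coord n (i : 'I_n) (v : 'rV[R]_n) : R := v 0 i.

Let row_coord_linear n (i : 'I_n) : linear (@row_coord n i).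
Proof. by move=> a u v; rewrite /row_coord !mxE. Qed.

HB.instance Definition _ n (i : 'I_n) :=
  GRing.isLinear.Build R 'rV[R]_n R *%R (@row_coord n i) (row_coord_linear i).

Let row_coord_continuous n (i : 'I_n) : continuous (@row_coord n i).
Proof. exact: coord_continuous. Qed.

Let row_frame_sum n (v : 'rV[R]_n) :
  v = \sum_i row_coord i v *: delta_mx 0 i.
Proof. exact: row_sum_delta. Qed.

Definition row_frame n : frame 'rV[R]_n :=
  Frame (@row_coord_continuous n) (@row_frame_sum n).

Context {V W : normedModType R} (e : frame V) (e' : frame W).

Definition pair_vec (i : frame_index e + frame_index e') : V * W :=
  match i with
  | inl i => (frame_vec e i, 0)
  | inr i => (0, frame_vec e' i)
  end.

Definition pair_coord (i : frame_index e + frame_index e') (z : V * W) : R :=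
  match i with
  | inl i => frame_coord e i z.1
  | inr i => frame_coord e' i z.2
  end.

Let pair_coord_linear i : linear (pair_coord i).
Proof. by case: i => i a u v /=; rewrite linearP. Qed.

HB.instance Definition _ i :=
  GRing.isLinear.Build R (V * W)%type R *%R (pair_coord i) (pair_coord_linear i).

Let pair_coord_continuous i : continuous (pair_coord i).
Proof.
case: i => i z; apply: continuous_comp.
- exact: cvg_fst.
- exact: frame_coord_continuous.
- exact: cvg_snd.
- exact: frame_coord_continuous.
Qed.

Let pair_frame_sum z : z = \sum_i pair_coord i z *: pair_vec i.
Proof.
apply: injective_projections; rewrite [RHS]raddf_sum big_sumType /=.
- rewrite [X in _ = _ + X]big1 => [|i _]; last by rewrite scaler0.
  by rewrite addr0 -frame_sum.
- rewrite [X in _ = X + _]big1 => [|i _]; last by rewrite scaler0.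
  by rewrite add0r -frame_sum.
Qed.

Definition pair_frame : frame (V * W)%type :=
  Frame pair_coord_continuous pair_frame_sum.

End frames.

Section Ck_comp.
Context {R : realType} {U V W : normedModType R} (e : frame V).

Lemma Ck_on_comp k (A : set U) (B : set V) (F : U -> V) (G : V -> W) :
  open A -> (forall x, A x -> B (F x)) -> Ck_on k A F -> Ck_on k B G ->
  Ck_on k A (G \o F).
Proof.
move=> oA AB; elim: k G => [|k IH] G.
  move=> cF cG x Ax; apply: continuous_comp; first exact: cF.
  by apply: cG; exact: AB.
move=> CF CG; have [dF CdF] := CF; have [dG CdG] := CG.
apply: (@Ck_on_is_diff _ _ _ _ _ _
  (fun x v => \sum_i frame_coord e i ('d F x v) *: 'd G (F x) (frame_vec e i)))
  => //.
- move=> x Ax.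
  have := @is_diff_comp _ _ _ _ F _ G _ x (differentiableP (dF x Ax))
    (differentiableP (dG _ (AB x Ax))).
  rewrite (_ : 'd G (F x) \o 'd F x = fun v => \sum_i
    frame_coord e i ('d F x v) *: 'd G (F x) (frame_vec e i)) //.
  apply/funext => v /=; rewrite [in LHS](frame_sum e ('d F x v)) linear_sum /=.
  by apply: eq_bigr => i _; rewrite linearZ.
- move=> v; apply: Ck_on_sum => // i; apply: Ck_onZ => //.
  + apply: (@Ck_on_linear _ _ _ _ _ _ (frame_coord e i)) => //.
      exact: frame_coord_continuous.
    exact: CdF.
  + exact: (IH (fun y => 'd G y (frame_vec e i)) (Ck_onW CF) (CdG _)).
Qed.

End Ck_comp.

(** * Charts and constant fields *)

Section charts.
Context {R : realType} {M : topologicalType} {V : normedModType R}.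

Lemma near_chart_inv (c : chart M V) (p : M) (P : M -> Prop) :
  chart_dom c p -> (\forall q \near p, P q) ->
  \forall x \near chart_map c p,
    [/\ chart_dom c (chart_inv c x), chart_map c (chart_inv c x) = x
      & P (chart_inv c x)].
Proof.
move=> cp Pp.
have img_p : (chart_map c @` chart_dom c) (chart_map c p) by exists p.
have nP : \forall x \near chart_map c p, P (chart_inv c x).
  by apply: (chart_inv_continuous img_p); rewrite chartK ?inE.
have ni : \forall x \near chart_map c p, (chart_map c @` chart_dom c) x.
  by apply: open_nbhs_nbhs; split=> //; exact: open_chart_img.
near=> x.
have [q cq qx] : (chart_map c @` chart_dom c) x by near: x.
have Px : P (chart_inv c x) by near: x.
by move: Px; rewrite -qx chartK ?inE.
Unshelve. all: by end_near. Qed.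

Lemma open_chart_image (c : chart M V) (U : set M) :
  open U -> open (chart_map c @` (chart_dom c `&` U)).
Proof.
move=> oU; rewrite openE => _ [p [cp Up] <-].
have := near_chart_inv cp (open_nbhs_nbhs (conj oU Up)).
by apply: filterS => x [cx xE Ux]; exists (chart_inv c x).
Qed.

End charts.

Section atlas.
Context {R : realType} {M : topologicalType} {V : normedModType R}.
Variable A : smooth_structure M V.
Implicit Types (i j k : chart_index A) (p q : M) (U : set M).

Local Notation dom i := (chart_dom (charts i)).
Local Notation phi i := (chart_map (charts i)).
Local Notation psi i := (chart_inv (charts i)).

Definition dtransition i j p : V -> V := 'd (phi j \o psi i) (phi i p).

Lemma differentiable_transition i j p : dom i p -> dom j p ->
  differentiable (phi j \o psi i) (phi i p).
Proof.
move=> ip jp; apply: (Ck_on_differentiable (smooth_transition i j 1)).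
by exists p.
Qed.

Lemma is_diff_chart_change {W : normedModType R} i j p (h : M -> W) (dh : V -> W) :
  dom i p -> dom j p -> is_diff (phi j p) (h \o psi j) dh ->
  is_diff (phi i p) (h \o psi i) (dh \o dtransition i j p).
Proof.
move=> ip jp hj.
apply: (@near_eq_is_diff _ _ _ ((h \o psi j) \o (phi j \o psi i))).
  have /(near_chart_inv ip) : \forall q \near p, dom j q.
    by apply: open_nbhs_nbhs; split=> //; exact: open_chart_dom.
  apply: filterS => x [_ _ jx] /=.
  by rewrite chartK ?inE.
apply: is_diff_comp; first exact/differentiableP/differentiable_transition.
by rewrite /= chartK ?inE.
Qed.

Lemma dtransition_comp i j k p v : dom i p -> dom j p -> dom k p ->
  dtransition j k p (dtransition i j p v) = dtransition i k p v.
Proof.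
move=> ip jp kp.
have [_ E] := is_diff_chart_change ip jp
  (differentiableP (differentiable_transition jp kp)).
by rewrite [in RHS]/dtransition E.
Qed.

Lemma dtransition_id i p v : dom i p -> dtransition i i p v = v.
Proof.
move=> ip; rewrite /dtransition.
have [_ ->//] : is_diff (phi i p) (phi i \o psi i) id.
apply: (@near_eq_is_diff _ _ _ id) (is_diff_id _).
have /(near_chart_inv ip) : \forall q \near p, True by exact: nearT.
by apply: filterS => x [_ /= -> _].
Qed.

(** The field with constant components [v] in the chart [i]. Its value at [q] is
    expressed, as every tangent vector is, in the chart chosen around [q]. *)
Definition const_field i (v : V) : vector_field A :=
  fun q => dtransition i (index_at A q) q v.

Lemma componentsE i p (v : tangent A p) :
  components i v = dtransition (index_at A p) i p v.
Proof. by []. Qed.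

Lemma components_const_field i j q v : dom i q -> dom j q ->
  components j (const_field i v q) = dtransition i j q v.
Proof. by move=> iq jq; apply: dtransition_comp => //; exact: mem_index_at. Qed.

Lemma const_field_components i q (v : tangent A q) : dom i q ->
  const_field i (components i v) q = v.
Proof.
move=> iq; have qq := mem_index_at A q.
by rewrite /const_field componentsE dtransition_comp ?dtransition_id.
Qed.

Lemma const_fieldE p v : const_field (index_at A p) v p = v.
Proof. by apply: dtransition_id; exact: mem_index_at. Qed.

Lemma components_id p (v : tangent A p) : components (index_at A p) v = v.
Proof. by apply: dtransition_id; exact: mem_index_at. Qed.

Section frame.
Variable e : frame V.

(** In the chart [j] this field reads [y |-> 'd (phi j \o psi i) y v], precomposed
    with the transition map from [j] to [i]. *)
Lemma smooth_const_field i v : smooth_field (dom i) (const_field i v).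
Proof.
move=> j k; have oA := open_overlap (charts j) (charts i).
apply: (@eq_Ck_on _ _ _ k _ ((fun y => 'd (phi j \o psi i) y v) \o
    (phi i \o psi j))) => //.
  move=> x; rewrite inE => -[q [jq iq] <-] /=.
  by rewrite chartK ?inE // components_const_field.
apply: (Ck_on_comp e (B := phi i @` (dom i `&` dom j))) => //.
- by move=> _ [q [jq iq] <-]; exists q => //=; rewrite chartK ?inE.
- exact: smooth_transition.
- by have [_] := smooth_transition i j k.+1; exact.
Qed.

Lemma smooth_fun_coord i (L : {linear V -> R}) :
  continuous L -> smooth_fun A (dom i) (L \o phi i).
Proof.
move=> cL j k; apply: (@Ck_on_linear _ _ _ _ _ _ L (phi i \o psi j)) => //.
- exact: open_overlap.
- exact: smooth_transition.
Qed.

(** The transition maps carry smoothness from one chart to all the others. *)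
Lemma smooth_fun_chart i U (h : M -> R) : open U ->
  smooth_on (phi i @` (dom i `&` U)) (h \o psi i) -> smooth_fun A (dom i `&` U) h.
Proof.
move=> oU sh j k.
have oD : open (phi j @` (dom j `&` (dom i `&` U))).
  by apply: open_chart_image; apply: openI => //; exact: open_chart_dom.
apply: (@eq_Ck_on _ _ _ k _ ((h \o psi i) \o (phi i \o psi j))) => //.
  by move=> x; rewrite inE => -[q [jq [iq Uq]] <-] /=; rewrite !chartK ?inE.
apply: (Ck_on_comp e (B := phi i @` (dom i `&` U))) => //.
- by move=> _ [q [jq iq] <-]; exists q => //=; rewrite chartK ?inE.
- apply: (@Ck_onS _ _ _ _ (phi j @` (dom j `&` dom i))); last first.
    exact: smooth_transition.
  by apply: image_subset => q [? []].
Qed.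

End frame.

Lemma smooth_fun_cst U (a : R) : open U -> smooth_fun A U (cst a).
Proof. by move=> oU i k; apply: Ck_on_cst; exact: open_chart_image. Qed.

Lemma eq_smooth_fun U (h1 h2 : M -> R) : open U -> {in U, h1 =1 h2} ->
  smooth_fun A U h1 -> smooth_fun A U h2.
Proof.
move=> oU E s i k; apply: eq_Ck_on (s i k); first exact: open_chart_image.
by move=> x; rewrite inE => -[q [iq Uq] <-] /=; rewrite chartK ?inE // E ?inE.
Qed.

Lemma smooth_funD U (h1 h2 : M -> R) : open U ->
  smooth_fun A U h1 -> smooth_fun A U h2 -> smooth_fun A U (fun q => h1 q + h2 q).
Proof.
move=> oU s1 s2 i k; apply: Ck_onD; first exact: open_chart_image.
- exact: s1.
- exact: s2.
Qed.

Lemma smooth_funM U (h1 h2 : M -> R) : open U ->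
  smooth_fun A U h1 -> smooth_fun A U h2 -> smooth_fun A U (fun q => h1 q * h2 q).
Proof.
move=> oU s1 s2 i k.
exact: (Ck_onZ (open_chart_image _ oU) (s1 i k) (s2 i k)).
Qed.

Lemma smooth_funS U U' (h : M -> R) : U' `<=` U ->
  smooth_fun A U h -> smooth_fun A U' h.
Proof.
by move=> s sh i k; apply: Ck_onS (sh i k); apply: image_subset; exact: setIS.
Qed.

Lemma smooth_fieldS U U' (X : vector_field A) : U' `<=` U ->
  smooth_field U X -> smooth_field U' X.
Proof.
by move=> s sh i k; apply: Ck_onS (sh i k); apply: image_subset; exact: setIS.
Qed.

Lemma smooth_fieldD U (X Y : vector_field A) : open U ->
  smooth_field U X -> smooth_field U Y -> smooth_field U (fun q => X q + Y q).
Proof.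
move=> oU sX sY i k /=.
under eq_fun do rewrite /components linearD.
by apply: Ck_onD; [exact: open_chart_image|exact: sX|exact: sY].
Qed.

Lemma smooth_fieldZ U (a : M -> R) (X : vector_field A) : open U ->
  smooth_fun A U a -> smooth_field U X -> smooth_field U (fun q => a q *: X q).
Proof.
move=> oU sa sX i k /=.
under eq_fun do rewrite /components linearZ.
by apply: (@Ck_onZ _ _ _ _ _ (a \o psi i));
  [exact: open_chart_image|exact: sa|exact: sX].
Qed.

Lemma smooth_field0 U : open U -> smooth_field U (fun q => 0 : tangent A q).
Proof.
move=> oU i k /=.
under eq_fun do rewrite /components linear0.
by apply: Ck_on_cst; exact: open_chart_image.
Qed.

Lemma smooth_field_sum U (I : Type) (r : seq I) (X : I -> vector_field A) :
  open U -> (forall l, smooth_field U (X l)) ->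
  smooth_field U (fun q => \sum_(l <- r) X l q).
Proof.
move=> oU sX; elim: r => [|l r IH].
  by under eq_fun do rewrite big_nil; exact: smooth_field0.
by under eq_fun do rewrite big_cons; exact: (smooth_fieldD oU (sX l) IH).
Qed.

Definition smooth_pairing (g : pairing A) :=
  forall U X Y, open U -> smooth_field U X -> smooth_field U Y ->
    smooth_fun A U (fun p => g p (X p) (Y p)).

Lemma smooth_scale_pairing (a : M -> R) (g : pairing A) :
  smooth_fun A setT a -> smooth_pairing g -> smooth_pairing (scale_pairing a g).
Proof.
move=> sa sg U X Y oU sX sY.
exact: (smooth_funM oU (smooth_funS (@subsetT _ U) sa) (sg U X Y oU sX sY)).
Qed.

End atlas.

(** * Connections in a chart *)

Section connections.
Context {R : realType} {M : topologicalType} {V : normedModType R}.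
Variables (A : smooth_structure M V) (e : frame V).
Implicit Types (i j k : chart_index A) (p q : M) (U : set M).

Local Notation dom i := (chart_dom (charts i)).
Local Notation phi i := (chart_map (charts i)).
Local Notation psi i := (chart_inv (charts i)).

Lemma derivation_near_cst p (v : tangent A p) (h : M -> R) (a : R) :
  (\forall q \near p, h q = a) -> derivation v h = 0.
Proof.
move=> ha; rewrite /derivation.
have [_ ->//] : is_diff (phi (index_at A p) p) (h \o psi (index_at A p)) 0.
apply: (@near_eq_is_diff _ _ _ (cst a)) (is_diff_cst _ _).
by have := near_chart_inv (mem_index_at A p) ha; apply: filterS => x [_ _ /= ->].
Qed.

Lemma derivation_const_field i p v (h : M -> R) (dh : V -> R) :
  dom i p -> is_diff (phi i p) (h \o psi i) dh ->
  derivation (const_field i v p) h = dh v.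
Proof.
move=> ip hi; have pp := mem_index_at A p.
have [_ E] := is_diff_chart_change pp ip hi.
by rewrite /derivation E /= dtransition_comp // dtransition_id.
Qed.

Lemma smooth_fun_near_differentiable p i (h : M -> R) : dom i p ->
  smooth_fun_near A p h -> differentiable (h \o psi i) (phi i p).
Proof.
move=> ip [U [oU Up] sh]; apply: (Ck_on_differentiable (sh i 1)).
by exists p.
Qed.

Definition local_rep i (Z : vector_field A) : V -> V :=
  fun x => components i (Z (psi i x)).

Lemma smooth_field_near_differentiable p i (Z : vector_field A) : dom i p ->
  smooth_field_near p Z -> differentiable (local_rep i Z) (phi i p).
Proof.
move=> ip [U [oU Up] sZ]; apply: (Ck_on_differentiable (sZ i 1)).
by exists p.
Qed.

Lemma smooth_const_field_near i p v : dom i p ->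
  smooth_field_near p (const_field i v).
Proof.
move=> ip; exists (dom i); last exact: smooth_const_field.
by split=> //; exact: open_chart_dom.
Qed.

Lemma smooth_fun_near_cst p (a : R) : smooth_fun_near A p (cst a).
Proof. by exists setT; [exact: open_nbhsT|apply: smooth_fun_cst; exact: openT]. Qed.

Variables (nabla : connection A) (nablaA : affine_connection nabla).

(** Connections are local. The indicator [h] of the set where [Y] and [Z] agree
    is smooth near [p], with derivative 0 and value 1 at [p], so the Leibniz rule
    gives [nabla v Y = nabla v (h *: Y)]; and [h *: Y = h *: Z] everywhere. *)
Lemma eq_connection p (v : tangent A p) (Y Z : vector_field A) :
  smooth_field_near p Y -> smooth_field_near p Z ->
  (\forall q \near p, Y q = Z q) -> nabla v Y = nabla v Z.
Proof.
move=> sY sZ YZ; pose h q : R := if `[< Y q = Z q >] then 1 else 0.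
have h1 : \forall q \near p, h q = 1.
  by apply: filterS YZ => q YZq; rewrite /h asboolT.
have sh : smooth_fun_near A p h.
  exists [set q | h q = 1]^°.
    by split; [exact: open_interior|exact: h1].
  apply: (@eq_smooth_fun _ _ _ _ _ (cst 1)); first exact: open_interior.
    by move=> q; rewrite inE => /interior_subset ->.
  by apply: smooth_fun_cst; exact: open_interior.
have hE X : smooth_field_near p X -> nabla v (fun q => h q *: X q) = nabla v X.
  move=> sX; rewrite (connection_leibniz nablaA) // (derivation_near_cst _ h1).
  by rewrite (nbhs_singleton h1) scale0r add0r scale1r.
rewrite -(hE Y) // -(hE Z) //; congr (nabla _ _).
apply: functional_extensionality_dep => q; rewrite /h.
by case: asboolP => [->//|_]; rewrite !scale0r.
Qed.

Lemma connection_sum p (v : tangent A p) (I : eqType) (r : seq I) (a : I -> M -> R)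
    (X : I -> vector_field A) U :
  open_nbhs p U -> (forall l, smooth_fun A U (a l)) ->
  (forall l, smooth_field U (X l)) ->
  nabla v (fun q => \sum_(l <- r) a l q *: X l q) =
  \sum_(l <- r) (derivation v (a l) *: X l p + a l p *: nabla v (X l)).
Proof.
move=> pU sa sX; have oU := pU.1.
have saX l : smooth_field U (fun q => a l q *: X l q) by exact: smooth_fieldZ.
elim: r => [|l r IH].
  under [X in nabla _ X]eq_fun do rewrite big_nil.
  rewrite big_nil.
  have s0 : smooth_field_near p (fun q => 0 : tangent A q).
    by exists U => //; exact: smooth_field0.
  have := connection_leibniz nablaA v (smooth_fun_near_cst p 0) s0.
  by under [X in nabla _ X]eq_fun do rewrite scaler0; rewrite scaler0 scale0r add0r.
under [X in nabla _ X]eq_fun do rewrite big_cons.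
rewrite big_cons -IH (connection_add nablaA).
- by rewrite (connection_leibniz nablaA) //; exists U.
- by exists U.
- exists U => //; exact: (smooth_field_sum r oU saX).
Qed.

(** The formula [nabla_v Z = d_v Z + Gamma(v, Z)] in the chart at [p]: near [p], [Z]
    is a combination of constant fields with its components as coefficients,
    and the Leibniz rule separates their derivatives from the Christoffel term. *)
Lemma connection_expand p (v : tangent A p) (Z : vector_field A) :
  smooth_field_near p Z ->
  nabla v Z = 'd (local_rep (index_at A p) Z) (phi (index_at A p) p) v
            + nabla v (const_field (index_at A p) (Z p)).
Proof.
move=> sZ; set i := index_at A p; have ip : dom i p by exact: mem_index_at.
have [U0 [oU0 Up0] sZ0] := sZ.
pose U := dom i `&` U0.
have oU : open U by apply: openI => //; exact: open_chart_dom.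
have Up : open_nbhs p U by split.
pose a l q := frame_coord e l (components i (Z q)).
pose E l := const_field i (frame_vec e l).
have sa l : smooth_fun A U (a l).
  apply: (smooth_fun_chart e) => // n.
  apply: (@Ck_on_linear _ _ _ _ _ _ (frame_coord e l) (local_rep i Z)).
  - exact: open_chart_image.
  - exact: frame_coord_continuous.
  - exact: sZ0.
have sE l : smooth_field U (E l).
  apply: (@smooth_fieldS _ _ _ _ (dom i)); first by move=> q [].
  exact: smooth_const_field.
have const_sum w q : const_field i w q = \sum_l frame_coord e l w *: E l q.
  rewrite [in LHS](frame_sum e w) /const_field /dtransition linear_sum.
  by apply: eq_bigr => l _; rewrite linearZ.
have -> : nabla v Z = nabla v (fun q => \sum_l a l q *: E l q).
  apply: eq_connection => //.
    exists U => //; apply: (smooth_field_sum _ oU) => l.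
    exact: smooth_fieldZ.
  apply: filterS (open_nbhs_nbhs Up) => q [iq _].
  by rewrite -const_sum const_field_components.
rewrite (connection_sum v _ Up sa sE) big_split /=.
have -> : const_field i (Z p) =
    (fun q => \sum_l (cst (frame_coord e l (Z p)) q : R) *: E l q).
  by apply: functional_extensionality_dep => q; exact: const_sum.
rewrite (connection_sum v _ Up (fun l => smooth_fun_cst _ oU) sE).
congr (_ + _).
  rewrite [RHS](frame_sum e); apply: eq_bigr => l _.
  rewrite /E const_fieldE; congr (_ *: _).
  rewrite /derivation -/i.
  have dZ := smooth_field_near_differentiable ip sZ.
  have [_ ->//] : is_diff (phi i p) (a l \o psi i)
      (frame_coord e l \o 'd (local_rep i Z) (phi i p)).
  apply: (@is_diff_comp _ _ _ _ (local_rep i Z)) (differentiableP dZ) _.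
  by apply: is_diff_linear; exact: frame_coord_continuous.
apply: eq_bigr => l _; rewrite (@derivation_near_cst _ _ _ (frame_coord e l (Z p))).
  by rewrite scale0r add0r /a components_id.
exact: nearW.
Qed.

End connections.

(** * Levi-Civita connections on constant fields *)

Section levi_civita.
Context {R : realType} {M : topologicalType} {V : normedModType R}.
Variables (A : smooth_structure M V) (e : frame V).
Implicit Types (i : chart_index A) (p q : M).

Local Notation dom i := (chart_dom (charts i)).
Local Notation phi i := (chart_map (charts i)).
Local Notation psi i := (chart_inv (charts i)).

(** Tested on the coordinate functions [h] of the chart, which separate tangent
    vectors: both [v(h)] and [w(h)] are constant, so the bracket kills [h]. *)
Lemma lie_bracket_const_field i p v w (b : tangent A p) : dom i p ->
  is_lie_bracket (const_field i v) (const_field i w) b -> b = 0.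
Proof.
move=> ip bE.
suff b0 l : frame_coord e l (components i b) = 0.
  have c0 : components i b = 0.
    by rewrite (frame_sum e (components i b)) big1 // => l _; rewrite b0 scale0r.
  rewrite -(const_field_components b ip) c0.
  by rewrite /const_field /dtransition linear0.
pose h : M -> R := frame_coord e l \o phi i.
have cl : continuous (frame_coord e l) by exact: frame_coord_continuous.
have hi q : dom i q -> is_diff (phi i q) (h \o psi i) (frame_coord e l).
  move=> iq; apply: (near_eq_is_diff _ (is_diff_linear _ cl)).
  have /(near_chart_inv iq) : \forall _ \near q, True by exact: nearT.
  by apply: filterS => x [_ xE _]; rewrite /h /= xE.
have idom : \forall q \near p, dom i q.
  by apply: open_nbhs_nbhs; split=> //; exact: open_chart_dom.
have near_cst u : \forall q \near p,
    derivation (const_field i u q) h = frame_coord e l u.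
  by apply: filterS idom => q iq; exact: (derivation_const_field _ iq (hi q iq)).
have sh : smooth_fun_near A p h.
  exists (dom i); last exact: smooth_fun_coord.
  by split=> //; exact: open_chart_dom.
have := bE h sh.
rewrite (derivation_near_cst _ (near_cst w)) (derivation_near_cst _ (near_cst v)).
rewrite subrr -[in derivation b](const_field_components b ip).
by rewrite (derivation_const_field _ ip (hi p ip)).
Qed.

Variables (g : pairing A) (nabla : connection A) (lc : levi_civita g nabla).

Lemma levi_civita_const_field_sym p (v w : tangent A p) :
  nabla v (const_field (index_at A p) w) =
  nabla w (const_field (index_at A p) v).
Proof.
have ip := mem_index_at A p.
have := levi_civita_torsion_free lc (smooth_const_field_near e v ip)
  (smooth_const_field_near e w ip).
move/(lie_bracket_const_field ip)/eqP; rewrite subr_eq0 => /eqP.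
by rewrite !const_fieldE.
Qed.

Lemma levi_civita_const_field_metric p (u v w : tangent A p) :
  derivation u (fun q => g (const_field (index_at A p) v q)
                           (const_field (index_at A p) w q)) =
    g (nabla u (const_field (index_at A p) v)) w +
    g v (nabla u (const_field (index_at A p) w)).
Proof.
have ip := mem_index_at A p.
rewrite (levi_civita_metric lc); try exact: smooth_const_field_near.
by rewrite !const_fieldE.
Qed.

End levi_civita.

(** * Pointwise algebra of metrics *)

Section metric_algebra.
Context {R : realType} {M : topologicalType} {V : normedModType R}.
Variables (A : smooth_structure M V) (g : pairing A).
Hypothesis g_riem : riemannian_metric g.

Lemma metricD p (x y w : tangent A p) : g (x + y) w = g x w + g y w.
Proof. by have := metric_linear g_riem w 1 x y; rewrite scale1r mul1r. Qed.

Lemma metricN p (x w : tangent A p) : g (- x) w = - g x w.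
Proof.
have g0 : g 0 w = 0 by apply: (addrI (g 0 w)); rewrite -metricD !addr0.
by apply: (addrI (g x w)); rewrite -metricD !subrr.
Qed.

Lemma metricB p (x y w : tangent A p) : g (x - y) w = g x w - g y w.
Proof. by rewrite metricD metricN. Qed.

Lemma metric_eq0 p (x : tangent A p) : g x x = 0 -> x = 0.
Proof.
move=> gx; apply/eqP/negP => /negP /(metric_gt0 g_riem).
by rewrite gx ltxx.
Qed.

End metric_algebra.

(** The algebra behind the uniqueness of the Levi-Civita connection: alternating
    the two symmetries six times returns to [S u v w] with the opposite sign. *)
Lemma sym_antisym_eq0 {R : realDomainType} {V : Type} (S : V -> V -> V -> R) :
  (forall u v w, S u v w = S v u w) -> (forall u v w, S u v w = - S u w v) ->
  forall u v w, S u v w = 0.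
Proof.
move=> sS aS u v w.
have : S u v w = - S u v w.
  rewrite {1}(aS u v w) (sS u w v) (aS w u v) opprK (sS w v u) (aS v w u).
  by rewrite (sS v u w).
by move=> h; lra.
Qed.

(** * The Levi-Civita connection of a product metric *)

Section product.
Context {R : realType} {M1 M2 : topologicalType} {V1 V2 : normedModType R}.
Variables (A1 : smooth_structure M1 V1) (A2 : smooth_structure M2 V2).
Let A := prod_structure A1 A2.

Lemma dtransition_prod (i j : chart_index A) (z : M1 * M2) (v : V1 * V2) :
  chart_dom (charts i) z -> chart_dom (charts j) z ->
  dtransition i j z v =
  (dtransition i.1 j.1 z.1 v.1, dtransition i.2 j.2 z.2 v.2).
Proof.
move=> [/= i1 i2] [/= j1 j2].
have [_ E] := is_diff_prod_map (z := chart_map (charts i) z)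
  (differentiableP (differentiable_transition i1 j1))
  (differentiableP (differentiable_transition i2 j2)).
by rewrite /dtransition E.
Qed.

Lemma const_field_prod (i : chart_index A) (z : M1 * M2) (v : V1 * V2) :
  chart_dom (charts i) z ->
  const_field i v z = (const_field i.1 v.1 z.1, const_field i.2 v.2 z.2).
Proof.
by move=> iz; rewrite /const_field dtransition_prod //; exact: mem_index_at.
Qed.

Lemma dmap_fst (z : M1 * M2) (v : tangent A z) : dmap A1 (@fst M1 M2) v = v.1.
Proof.
rewrite /dmap.
have [_ ->//] : is_diff (chart_map (chart_at A z) z)
  (chart_map (chart_at A1 z.1) \o fst \o chart_inv (chart_at A z)) fst.
apply: (near_eq_is_diff _ (is_diff_fst _)).
have /(near_chart_inv (mem_index_at A z)) : \forall _ \near z, True.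
  exact: filterE.
by apply: filterS => x [_ xE _]; rewrite -[in LHS]xE.
Qed.

Lemma dmap_snd (z : M1 * M2) (v : tangent A z) : dmap A2 (@snd M1 M2) v = v.2.
Proof.
rewrite /dmap.
have [_ ->//] : is_diff (chart_map (chart_at A z) z)
  (chart_map (chart_at A2 z.2) \o snd \o chart_inv (chart_at A z)) snd.
apply: (near_eq_is_diff _ (is_diff_snd _)).
have /(near_chart_inv (mem_index_at A z)) : \forall _ \near z, True.
  exact: filterE.
by apply: filterS => x [_ xE _]; rewrite -[in LHS]xE.
Qed.

Lemma derivation_prod (z : M1 * M2) (u : tangent A z) (h : M1 * M2 -> R)
    (h1 : M1 -> R) (h2 : M2 -> R) :
  (\forall q \near z, h q = h1 q.1 + h2 q.2) ->
  smooth_fun_near A1 z.1 h1 -> smooth_fun_near A2 z.2 h2 ->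
  derivation u h = derivation (u.1 : tangent A1 z.1) h1
                 + derivation (u.2 : tangent A2 z.2) h2.
Proof.
move=> hE s1 s2; rewrite /derivation.
have d1 := smooth_fun_near_differentiable (mem_index_at A1 z.1) s1.
have d2 := smooth_fun_near_differentiable (mem_index_at A2 z.2) s2.
pose z' := chart_map (chart_at A z) z.
have e1 : is_diff z' ((h1 \o chart_inv (chart_at A1 z.1)) \o fst) _ :=
  is_diff_comp (is_diff_fst z') (differentiableP d1).
have e2 : is_diff z' ((h2 \o chart_inv (chart_at A2 z.2)) \o snd) _ :=
  is_diff_comp (is_diff_snd z') (differentiableP d2).
have eh : \forall x \near z',
    (((h1 \o chart_inv (chart_at A1 z.1)) \o fst) +
     ((h2 \o chart_inv (chart_at A2 z.2)) \o snd)) x =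
    (h \o chart_inv (chart_at A z)) x.
  have := near_chart_inv (mem_index_at A z) hE.
  by apply: filterS => x [_ _ /= ->].
by have [_ ->] := near_eq_is_diff eh (is_diffD e1 e2).
Qed.

Variables (e1 : frame V1) (e2 : frame V2).
Variables (h1 : pairing A1) (h2 : pairing A2) (g : pairing A).
Hypotheses (h1_smooth : smooth_pairing h1) (h2_smooth : smooth_pairing h2).
Hypothesis g_riem : riemannian_metric g.
Hypothesis gE : forall z (u v : tangent A z),
  g u v = h1 (u.1 : tangent A1 z.1) v.1 + h2 (u.2 : tangent A2 z.2) v.2.
Variables (nabla1 : connection A1) (nabla2 : connection A2) (nabla : connection A).
Hypotheses (lc1 : levi_civita h1 nabla1) (lc2 : levi_civita h2 nabla2)
  (lc : levi_civita g nabla).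

(** On constant fields, the difference [T] of the two sides is symmetric,
    because both connections are torsion-free, and [g (T u v) w] is antisymmetric
    in [v] and [w], because both differentiate
    [g (E v) (E w) = h1 (E v.1) (E w.1) + h2 (E v.2) (E w.2)] in the same way.
    Hence [T = 0]. *)
Lemma levi_civita_prod (z : M1 * M2) (u w : tangent A z) :
  nabla u (const_field (index_at A z) w) =
  (nabla1 (u.1 : tangent A1 z.1) (const_field (index_at A1 z.1) w.1),
   nabla2 (u.2 : tangent A2 z.2) (const_field (index_at A2 z.2) w.2)).
Proof.
pose e := pair_frame e1 e2.
pose n (u w : tangent A z) : tangent A z :=
  (nabla1 (u.1 : tangent A1 z.1) (const_field (index_at A1 z.1) w.1),
   nabla2 (u.2 : tangent A2 z.2) (const_field (index_at A2 z.2) w.2)).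
pose T (u w : tangent A z) : tangent A z :=
  nabla u (const_field (index_at A z) w) - n u w.
suff T0 : T u w = 0 by apply/eqP; rewrite -subr_eq0; apply/eqP; exact: T0.
suff S0 : forall a b c, g (T a b) c = 0 by exact: (metric_eq0 g_riem).
move=> {u w}.
apply: (@sym_antisym_eq0 _ _ (fun u v w => g (T u v) w)) => [u v w|u v w].
  rewrite /T (levi_civita_const_field_sym e lc) /n.
  by rewrite (levi_civita_const_field_sym e1 lc1)
    (levi_civita_const_field_sym e2 lc2).
have m := levi_civita_const_field_metric e lc u v w.
have m1 := levi_civita_const_field_metric e1 lc1
  (u.1 : tangent A1 z.1) (v.1 : tangent A1 z.1) w.1.
have m2 := levi_civita_const_field_metric e2 lc2
  (u.2 : tangent A2 z.2) (v.2 : tangent A2 z.2) w.2.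
move: m; rewrite (@derivation_prod _ _ _
    (fun q => h1 (const_field (index_at A1 z.1) v.1 q)
                 (const_field (index_at A1 z.1) w.1 q))
    (fun q => h2 (const_field (index_at A2 z.2) v.2 q)
                 (const_field (index_at A2 z.2) w.2 q))).
- rewrite m1 m2 /T !metricB // (Defs.metric_sym g_riem _ v).
  rewrite (Defs.metric_sym g_riem (n u w)).
  rewrite (gE (n u v)) (gE v (n u w)) /n /=.
  move=> m; lra.
- have : \forall q \near z, chart_dom (charts (index_at A z)) q.
    apply: open_nbhs_nbhs; split; first exact: open_chart_dom.
    exact: mem_index_at.
  by apply: filterS => q iq; rewrite gE !const_field_prod.
- exists (chart_dom (charts (index_at A1 z.1))).
    by split; [exact: open_chart_dom|exact: mem_index_at].
  by apply: h1_smooth; try exact: smooth_const_field; exact: open_chart_dom.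
- exists (chart_dom (charts (index_at A2 z.2))).
    by split; [exact: open_chart_dom|exact: mem_index_at].
  by apply: h2_smooth; try exact: smooth_const_field; exact: open_chart_dom.
Qed.

End product.

(** * Normal components and the difference tensor *)

Lemma normal_componentP {R : realType} {M N : topologicalType}
    {V W : normedModType R} (A : smooth_structure M V) (B : smooth_structure N W)
    (F : M -> N) (g : pairing B) (p : M) (w u : tangent B (F p)) :
  riemannian_metric g ->
  (forall v : tangent A p, g (F p) u (dmap B F v) = 0) ->
  range (fun v : tangent A p => dmap B F v) (w - u) ->
  normal_component A g w = u.
Proof.
move=> g_riem un wu; apply: xget_subset1 => // u1 u2 [n1 [v1 _ E1]] [n2 [v2 _ E2]].
apply/eqP; rewrite -subr_eq0; apply/eqP/(metric_eq0 g_riem).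
have -> : g (F p) (u1 - u2) (u1 - u2) = g (F p) (u1 - u2) (dmap B F (v2 - v1)).
  congr (g _ _ _); rewrite /dmap linearB /= -!/(dmap _ _ _) E1 E2.
  by rewrite opprB [RHS]addrC addrA subrK.
by rewrite metricB // n1 n2 subrr.
Qed.

Lemma normal_component_tangent {R : realType} {M N : topologicalType}
    {V W : normedModType R} (A : smooth_structure M V) (B : smooth_structure N W)
    (F : M -> N) (g : pairing B) (p : M) (v : tangent A p) (w : tangent B (F p)) :
  normal_component A g (dmap B F v + w) = normal_component A g w.
Proof.
congr (xget _ _); apply/seteqP; split=> u [un [c _ cE]]; split=> //.
- exists (c - v) => //.
  by rewrite /dmap linearB /= -!/(dmap _ _ _) cE addrAC [_ + w]addrC addrK.
- exists (v + c) => //.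
  by rewrite /dmap linearD /= -!/(dmap _ _ _) cE addrA.
Qed.

(** Two connections have the same derivative term [d_X Z] in a chart, which cancels
    in their difference; what is left only depends on the value of [Z] at [p]. *)
Lemma difference_tensorE {R : realType} {M : topologicalType} {V : normedModType R}
    (A : smooth_structure M V) (e : frame V) (nabla' nabla : connection A)
    (p : M) (X Y : tangent A p) :
  affine_connection nabla' -> affine_connection nabla ->
  difference_tensor nabla' nabla X Y =
  nabla' p X (const_field (index_at A p) Y) -
  nabla p X (const_field (index_at A p) Y).
Proof.
move=> a' a; set d := RHS.
have dE Z : smooth_field_near p Z -> Z p = Y -> nabla' p X Z - nabla p X Z = d.
  move=> sZ ZY; rewrite (connection_expand e a' _ sZ) (connection_expand e a _ sZ).
  by rewrite ZY opprD addrACA subrr add0r.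
apply: xget_subset1.
  exists (const_field (index_at A p) Y); split=> //.
    by apply: smooth_const_field_near => //; exact: mem_index_at.
  exact: const_fieldE.
by move=> _ _ [Z1 [s1 E1 ->]] [Z2 [s2 E2 ->]]; rewrite !dE.
Qed.

(** * The diagonal *)

Section diagonal.
Context {R : realType} {M : topologicalType} {V : normedModType R}.
Variables (A : smooth_structure M V) (e : frame V).
Let A2 := prod_structure A A.
Let Xi (p : M) : M * M := (p, p).

Lemma dmap_diag (p : M) (X : tangent A p) : dmap A2 Xi X = (X, X).
Proof.
rewrite /dmap.
have [_ ->//] : is_diff (chart_map (chart_at A p) p)
  (chart_map (chart_at A2 (Xi p)) \o Xi \o chart_inv (chart_at A p))
  (fun v => (v, v)).
apply: (near_eq_is_diff _ (is_diff_diag _)).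
have /(near_chart_inv (mem_index_at A p)) : \forall _ \near p, True.
  exact: filterE.
by apply: filterS => x [_ xE _]; rewrite -[in LHS]xE.
Qed.

(** Along the diagonal, the components of [Z] are of the form [(z, z)], hence so is
    their derivative in a direction tangent to the diagonal. *)
Lemma connection_diag (nabla : connection A2) (p : M) (X : tangent A p)
    (Z : vector_field A2) :
  affine_connection nabla -> smooth_field_near (Xi p) Z ->
  (\forall q \near p, range (fun v : tangent A q => dmap A2 Xi v) (Z (Xi q))) ->
  exists t : tangent A p, nabla (Xi p) (X, X) Z =
    (t, t) + nabla (Xi p) (X, X) (const_field (index_at A2 (Xi p)) (Z (Xi p))).
Proof.
move=> na sZ tZ; pose i := index_at A p; pose x := chart_map (charts i) p.
have ip : chart_dom (charts i) p by exact: mem_index_at.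
rewrite (connection_expand (pair_frame e e) na _ sZ).
pose L := local_rep (index_at A2 (Xi p)) Z.
have dL : differentiable L (x, x).
  exact: (smooth_field_near_differentiable (mem_index_at A2 (Xi p)) sZ).
rewrite -/L -[chart_map _ _]/(x, x).
exists ('d L (x, x) (X, X)).1; congr (_ + _).
apply/eqP; rewrite -pair_eqE /= eqxx /= eq_sym -subr_eq0; apply/eqP.
have Ld : is_diff x (fun y => L (y, y)) (fun v => 'd L (x, x) (v, v)).
  exact: (@is_diff_comp _ _ _ _ (fun y => (y, y)) (fun v => (v, v)) L _ x
    (is_diff_diag _) (differentiableP dL)).
(* [D1] and [D0] compute the differential at [x] of [y |-> (L (y, y)).1 - (L (y, y)).2],
   a function that vanishes near [x]. *)
have D1 := is_diffB (is_diff_comp Ld (is_diff_fst _))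
  (is_diff_comp Ld (is_diff_snd _)).
have D0 : is_diff x (cst 0 : V -> V) 0 by exact: is_diff_cst.
have := @near_eq_is_diff _ _ _ _
  ((fst \o (fun y => L (y, y))) - (snd \o (fun y => L (y, y)))) _ x _ D0.
case.
  have : \forall q \near p, chart_dom (charts i) q /\
      range (fun v : tangent A q => dmap A2 Xi v) (Z (Xi q)).
    apply: filterI tZ; apply: open_nbhs_nbhs; split=> //; exact: open_chart_dom.
  move=> /(near_chart_inv ip); apply: filterS => y [iy yE [_ [v _ vE]]].
  apply/esym/eqP; rewrite subr_eq0 /=; apply/eqP.
  rewrite /L /local_rep -[chart_inv _ _]/(Xi (chart_inv (charts i) y)) -vE.
  rewrite dmap_diag componentsE dtransition_prod //.
  exact: mem_index_at.
move=> _; have [_ ->] := D1 => /(congr1 (fun f => f X)) /= E.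
by rewrite -[RHS]E.
Qed.

Variables (h0 h1 : pairing A) (g : pairing A2).
Hypotheses (h0_smooth : smooth_pairing h0) (h1_smooth : smooth_pairing h1).
Hypothesis g_riem : riemannian_metric g.
Hypothesis gE : forall z (u v : tangent A2 z),
  g u v = h0 (u.1 : tangent A z.1) v.1 + h1 (u.2 : tangent A z.2) v.2.
Variables (nabla nabla' : connection A) (nablabar : connection A2).
Hypotheses (lc : levi_civita h0 nabla) (lc' : levi_civita h1 nabla')
  (lcbar : levi_civita g nablabar).

(** For an extension [Z] of [(Y, Y)] tangent to the diagonal, the two components of
    the derivative of [Z] along [(X, X)] differ by the difference tensor, and
    subtracting the tangent vector with both components equal to the first one
    leaves [(0, D X Y)]. *)
Lemma second_fundamental_form_diag (p : M) (X Y : tangent A p) :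
  second_fundamental_form A A2 Xi g nablabar p (X, X) (Y, Y) =
  normal_component A g
    ((0, difference_tensor nabla' nabla X Y) : tangent A2 (Xi p)).
Proof.
set n := RHS.
have nE (Z : vector_field A2) : smooth_field_near (Xi p) Z ->
    (\forall q \near p, range (fun v : tangent A q => dmap A2 Xi v) (Z (Xi q))) ->
    Z (Xi p) = (Y, Y) ->
    normal_component A g (nablabar ((X, X) : tangent A2 (Xi p)) Z) = n.
  move=> sZ tZ ZE.
  have [t ->] := connection_diag X (levi_civita_affine lcbar) sZ tZ.
  rewrite ZE (levi_civita_prod e e h0_smooth h1_smooth g_riem gE lc lc' lcbar) /=.
  rewrite /n (difference_tensorE e _ _ (levi_civita_affine lc')
    (levi_civita_affine lc)).
  set a := nabla _ _; set b := nabla' _ _.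
  have -> : ((t, t) + (a, b) : tangent A2 (Xi p)) =
      dmap A2 Xi (t + a : tangent A p) + (0, b - a).
    rewrite dmap_diag -[LHS]/(t + a, t + b) -[RHS]/(t + a + 0, t + a + (b - a)).
    by rewrite addr0 -addrA [a + _]addrC subrK.
  exact: normal_component_tangent.
apply: xget_subset1.
  pose i := index_at A2 (Xi p); pose Z : vector_field A2 := const_field i (Y, Y).
  have ip : chart_dom (charts i) (Xi p) by exact: mem_index_at.
  have sZ : smooth_field_near (Xi p) Z.
    exact: (smooth_const_field_near (pair_frame e e)).
  have tZ :
      \forall q \near p, range (fun v : tangent A q => dmap A2 Xi v) (Z (Xi q)).
    have : \forall q \near p, chart_dom (charts (index_at A p)) q.
      apply: open_nbhs_nbhs; split; first exact: open_chart_dom.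
      exact: mem_index_at.
    apply: filterS => q iq; rewrite /Z const_field_prod //=.
    by exists (const_field (index_at A p) Y q); rewrite ?dmap_diag.
  have Zp : Z (Xi p) = (Y, Y) by exact: const_fieldE.
  by exists Z; split=> //; rewrite nE.
by move=> _ _ [Z1 [s1 t1 E1 ->]] [Z2 [s2 t2 E2 ->]]; rewrite !nE.
Qed.

(** [(- P s, s)] is normal since [h0 (P s) v = h1 s v], and [(0, d)] exceeds it by
    [(P s, d - s)], which lies on the diagonal exactly when [(1 + P) s = d]. *)
Lemma normal_component_diag (p : M) (P : tangent A p -> tangent A p)
    (s d : tangent A p) :
  (forall x y : tangent A p, h0 (- P x : tangent A p) y = - h1 x y) -> s + P s = d ->
  normal_component A g ((0, d) : tangent A2 (Xi p)) = (- P s, s).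
Proof.
move=> hP <-; apply: normal_componentP => // [v|].
  by rewrite dmap_diag gE /= hP addNr.
exists (P s) => //; rewrite dmap_diag -[RHS]/(0 - - P s, s + P s - s).
by rewrite opprK add0r addrAC subrr add0r.
Qed.

End diagonal.

Theorem lemma3 (R : realType) (n : nat) (M : topologicalType)
    (M_hausdorff : hausdorff_space M) (M_countable : @second_countable M)
    (A : smooth_structure M 'rV[R]_n)
    (g0 g1 : pairing A)
    (g0_riem : riemannian_metric g0) (g1_riem : riemannian_metric g1)
    (f : M -> R) (f_smooth : smooth_fun A setT f)
    (f01 : forall p, 0 <= f p <= 1) :
  let A2 := prod_structure A A in
  let h0 : pairing A := scale_pairing (fun p => 1 - f p) g0 in
  let h1 : pairing A := scale_pairing f g1 in
  let gbar : pairing A2 :=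
    fun z u v => pullback (A := A2) (@fst M M) h0 u v
               + pullback (A := A2) (@snd M M) h1 u v in
  let Xi : M -> M * M := fun p => (p, p) in
  forall (gbar_riem : riemannian_metric gbar)
    (nabla nabla' : connection A) (nablabar : connection A2)
    (nabla_lc : levi_civita h0 nabla)
    (nabla'_lc : levi_civita h1 nabla')
    (nablabar_lc : levi_civita gbar nablabar)
    (P : forall p : M, {linear tangent A p -> tangent A p})
    (PE : forall p, comparison_endomorphism f g0 g1 (P p)),
  let dXi (p : M) (X : tangent A p) : tangent A2 (Xi p) := dmap A2 Xi X in
  let sigma (p : M) (u v : tangent A2 (Xi p)) : tangent A2 (Xi p) :=
    second_fundamental_form A A2 Xi gbar nablabar p u v in
  let D (p : M) (X Y : tangent A p) : tangent A p :=
    difference_tensor nabla' nabla X Y in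
  forall (p : M) (X Y X' Y' : tangent A p),
    gbar (Xi p) (sigma p (dXi p X) (dXi p Y)) (sigma p (dXi p X') (dXi p Y')) =
    f p * g1 p (((\1 + linfun (P p))^-1)%VF (D p X Y)) (D p X' Y').
Proof.
move=> A2 h0 h1 gbar Xi gbar_riem nabla nabla' nablabar lc lc' lcbar P PE dXi.
move=> sigma D p X Y X' Y'.
pose e : frame 'rV[R]_n := row_frame n.
have gbarE z (u v : tangent A2 z) : gbar z u v =
    h0 z.1 (u.1 : tangent A z.1) v.1 + h1 z.2 (u.2 : tangent A z.2) v.2.
  by rewrite /gbar /pullback !dmap_fst !dmap_snd.
have h0_smooth : smooth_pairing h0.
  apply: smooth_scale_pairing (metric_smooth g0_riem).
  have := smooth_funD openT (smooth_fun_cst (A := A) 1 openT)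
    (smooth_funM openT (smooth_fun_cst (A := A) (-1) openT) f_smooth).
  by under eq_fun do rewrite mulN1r.
have h1_smooth : smooth_pairing h1.
  exact: smooth_scale_pairing f_smooth (metric_smooth g1_riem).
pose H0 (x y : tangent A p) := h0 p x y.
pose H1 (x y : tangent A p) := h1 p x y.
have H0D x y z : H0 (x + y) z = H0 x z + H0 y z.
  by rewrite /H0 /h0 /scale_pairing metricD // mulrDr.
have H1D x y z : H1 x (y + z) = H1 x y + H1 x z.
  rewrite /H1 /h1 /scale_pairing !(Defs.metric_sym g1_riem x).
  by rewrite metricD // mulrDr.
have H0C x y : H0 x y = H0 y x.
  by rewrite /H0 /h0 /scale_pairing (Defs.metric_sym g0_riem).
have H0N x y : H0 (- x) y = - H0 x y.
  by rewrite /H0 /h0 /scale_pairing metricN // mulrN.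
have HP x y : H0 (P p x) y = H1 x y by exact: (comparisonE (PE p)).
pose one_P := (\1 + linfun (P p))%VF.
have one_PE x : one_P x = x + P p x by rewrite add_lfunE id_lfunE lfunE.
have one_P_inj : lker one_P == 0%VS.
  apply/lker0P => x y xyE; apply/eqP; rewrite -subr_eq0; apply/eqP.
  have : (x - y) + P p (x - y) = 0.
    rewrite -one_PE linearB; apply/eqP; rewrite subr_eq0; apply/eqP; exact: xyE.
  set d := x - y => dE.
  (* gbar (d, d) (d, d) = h0 d d + h0 (P d) d = h0 ((1 + P) d) d = 0 *)
  suff : ((d, d) : tangent A2 (Xi p)) = 0 by case.
  apply: (metric_eq0 gbar_riem).
  rewrite gbarE /= -/(H0 _ _) -/(H1 _ _) -HP -H0D.
  by rewrite dE -(addNr d) H0D H0N addNr.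
have one_PK d : one_P (one_P^-1%VF d) = d by exact: lker0_lfunVK.
have sigmaE x y : sigma p (dXi p x) (dXi p y) =
    (- P p (one_P^-1%VF (D p x y)), one_P^-1%VF (D p x y)).
  rewrite /dXi !dmap_diag /sigma.
  rewrite (second_fundamental_form_diag e h0_smooth h1_smooth gbar_riem gbarE
    lc lc' lcbar).
  apply: (normal_component_diag gbar_riem gbarE) => [u v|].
    by rewrite -/(H0 _ _) -/(H1 _ _) H0N HP.
  by rewrite -one_PE one_PK.
rewrite !sigmaE gbarE /= -/(H0 _ _) -/(H1 _ _).
set s := one_P^-1%VF (D p X Y); set s' := one_P^-1%VF (D p X' Y').
(* H0 (P s) (P s') + H1 s s' = H1 s ((1 + P) s') *)
rewrite -[RHS]/(H1 s (D p X' Y')) -[D p X' Y'](one_PK) -/s' one_PE.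
by rewrite H0N [H0 _ (- _)]H0C H0N opprK [H0 _ (P p s)]H0C HP H1D addrC.
Qed.
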